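(* Let $\mathbb{F}_q$ be a finite field of odd characteristic, let $r\ge 2$, and let $f_1,\ldots,f_r$ be a dynamically-irreducible set of (distinct) monic quadratic polynomials over $\mathbb{F}_q$, written as $f_i(X)=(X-b_i)^2+c_i$ with $b_i,c_i\in\mathbb{F}_q$. Then the set $$\{c_1,\ldots,c_r\}\cup\left\{\left(f_{i_1}\circ f_{i_2}\circ\cdots\circ f_{i_n}\right)(c_j) : n\ge 1,\ 1\le i_1,\ldots,i_n,j\le r\right\}\subseteq\mathbb{F}_q$$ has size at most $4(\log q)^2\sqrt{q}$ (a bound uniform in $r$).
   Context: A set of polynomials $f_1,\ldots,f_r$ of positive degree over a finite field $\mathbb{F}_q$ is called dynamically-irreducible if all polynomials formed by composition of $f_1,\ldots,f_r$, i.e. all $f_{i_1}\circ f_{i_2}\circ\cdots\circ f_{i_n}$ with $n\ge 1$ and $i_1,\ldots,i_n\in\{1,\ldots,r\}$ (repetitions allowed), are irreducible over $\mathbb{F}_q$. Here $\log$ is the natural logarithm. *)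

(* Defs.v *)
From HB Require Import structures.
From mathcomp Require Import all_boot all_order all_algebra.
From mathcomp Require Import boolp.

Set Implicit Arguments.
Unset Strict Implicit.
Unset Printing Implicit Defensive.

Import GRing.Theory.
Local Open Scope ring_scope.

Section DynamicallyIrreducible.
Variables (F : finFieldType) (r : nat).
Implicit Types (f : 'I_r -> {poly F}) (c : 'I_r -> F) (s : seq 'I_r).

(* f_(i_1) \o f_(i_2) \o ... \o f_(i_n) for s = [:: i_1; ...; i_n]; the empty
   word gives the identity 'X and is excluded wherever n >= 1 is required. *)
Definition word_comp f s : {poly F} := foldr (fun i p => f i \Po p) 'X s.

(* Positivity of the degrees of the f_i is part of irreducible_poly (take s of
   length one). *)
Definition dynamically_irreducible f : Prop :=
  forall s, s != [::] -> irreducible_poly (word_comp f s).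

(* The second component is not a bounded search, hence the classical
   comprehension. *)
Definition orbit_values f c : {set F} :=
  [set c j | j : 'I_r] :|:
  [set x | `[< exists s j, s != [::] /\ x = (word_comp f s).[c j] >]].

End DynamicallyIrreducible.

(* Main.v *)
Require Import Defs.
From HB Require Import structures.
From mathcomp Require Import all_boot all_order all_algebra.
From mathcomp Require Import qpoly finfield qfpoly.
From mathcomp Require Import boolp reals sequences exp ring lra zify.

(** Write [q] for the number of elements of [F], which is odd.

    Let [g] be a nonempty composition of the [f i].  If [g.[c j]] were a square,
    [g \Po f j] would be reducible: over the residue field of [g], of degree
    [n] over [F] with [n] even, [g.[c j]] is the norm of [c j - x], so
    [x - c j] has a square root there and [g \Po f j] has a root in a field of
    degree [n] rather than [2 * n] ([irreducible_comp_nonsquare]).  The set of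
    the theorem is stable under the [f i], so every nonempty composition takes
    only nonsquare values on it ([word_comp_orbit_nonsquare]).

    Two distinct quadratics [f i0] and [f i1] freely generate a monoid under
    composition ([word_comp_inj]).  Let [4 ^ m <= q < 4 ^ m.+1] and choose [m]
    distinct compositions [G 1, ..., G m] of [k] factors among [f i0] and
    [f i1], with [m <= 2 ^ k <= 2 * m].  If [N] is the size of the set and
    [chi] is the quadratic character, expanding the product of the
    [1 - chi (G i)], which is [2 ^ m] at each point of the set and nonnegative
    elsewhere, gives [2 ^ m * N <= q + 2 ^ m * E], where [E] bounds the
    character sums of the products of nonempty subfamilies of the [G i]
    ([card_all_nonsquares]).  Such a product has degree at most
    [d := m * 2 ^ k <= 2 * m ^ 2], and it is not a constant times a square since
    its factors are distinct irreducible polynomials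
    ([prod_irreducible_nonsquare]).

    The character sums are bounded by the method of Stepanov ([stepanov]): with
    [l] the integer part of the square root of [q], a nonzero polynomial of the
    form [g ^ l * (sum_j k0_j X ^ (q j) + (sum_j k1_j X ^ (q j)) * g ^ (q./2))]
    vanishes to order [l] at all [x] with [g.[x] ^ (q./2) = e], and comparing
    with its degree gives [E] close to [3 * d * sqrt q] ([charsum_le]).

    Hence [N <= (6 * m ^ 2 + 10) * sqrt q].  Since [ln q >= 2 * m * ln 2] and
    [ln 2 >= 2 / 3], this is at most [4 * (ln q) ^ 2 * sqrt q] as soon as
    [m >= 8].  For smaller [m], [4 * (ln q) ^ 2 * sqrt q] is at least [q]. *)

Set Implicit Arguments.
Unset Strict Implicit.
Unset Printing Implicit Defensive.

Import Order.TTheory GRing.Theory Num.Theory.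
Local Open Scope ring_scope.

(** * Irreducibility of a composition and nonsquare values *)

Section ResidueField.

Variable F : finFieldType.
Local Notation q := #|F|.

Lemma expr_card_iterE (p : {poly F}) n : p ^+ (q ^ n) = p \Po 'X^(q ^ n).
Proof.
have [l l_pr lF] := finPcharP F.
have lq : [pchar {poly F}].-nat (q ^ n)%N.
  rewrite (eq_pnat _ (pchar_poly _)) (eq_pnat _ (pcharf_eq lF)).
  by rewrite (card_pprimeChar lF) -expnM pnatX pnat_id.
have constE (c : F) : c ^+ (q ^ n) = c.
  by elim: n {lq} => [|n IH]; rewrite ?expr1 // expnSr exprM IH expf_card.
have qn0 : (q ^ n)%N != 0%N by rewrite -lt0n expn_gt0 (ltnW (finNzRing_gt1 F)).
elim/poly_ind: p => [|p c IH]; first by rewrite comp_poly0 expr0n (negPf qn0).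
by rewrite exprDn_pchar // exprMn IH comp_poly_MXaddC -polyC_exp constE.
Qed.

Lemma expr_cardE (p : {poly F}) : p ^+ q = p \Po 'X^q.
Proof. by have := expr_card_iterE p 1; rewrite expn1. Qed.

(** [phi] is the reduction modulo [g], onto the residue field of [g]. *)
Lemma residue_field (g : {poly F}) :
    irreducible_poly g -> g \is monic ->
  exists (K : finFieldType) (phi : {rmorphism {poly F} -> K}),
    [/\ forall z, exists p, z = phi p, forall p, (phi p == 0) = (g %| p)
      & #|K| = (q ^ (size g).-1)%N].
Proof.
move=> g_irr g_mon; pose gI : monic_irreducible_poly g := (g_irr, g_mon).
exists {poly %/ g with gI}.
exists (in_qpoly g : {rmorphism {poly F} -> {poly %/ g with gI}}).
split=> [z | p |]; last exact: card_qfpoly.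
- by exists (val z); apply/val_inj; rewrite /= [RHS]in_qpoly_small ?size_mk_monic.
- by rewrite -val_eqE /= -Pdiv.IdomainMonic.modpE ?(mk_monicE gI).
Qed.

Section Quotient.

Variables (g : {poly F}) (K : finFieldType) (phi : {rmorphism {poly F} -> K}).
Hypotheses (g_irr : irreducible_poly g) (g_mon : g \is monic).
Hypothesis phi_surj : forall z, exists p, z = phi p.
Hypothesis phi_eq0 : forall p, (phi p == 0) = (g %| p).
Hypothesis cardK : #|K| = (q ^ (size g).-1)%N.

(** If [x ^+ (q ^ n) = x] for the class [x] of ['X], then all the elements of
    the residue field are roots of ['X^(q ^ n) - 'X]. *)
Lemma size_le_frobenius_fixed n :
  (0 < n)%N -> g %| 'X^(q ^ n) - 'X -> ((size g).-1 <= n)%N.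
Proof.
move=> n_gt0 gX; have q1 := finNzRing_gt1 F.
have qn1 : (1 < q ^ n)%N by rewrite (ltn_exp2l 0).
have Nz : ('X^(q ^ n) - 'X : {poly K}) != 0.
  rewrite -size_poly_gt0 size_polyDl ?size_polyN ?size_polyX ?size_polyXn ?ltnS //.
have rootK (z : K) : root ('X^(q ^ n) - 'X) z.
  have [p ->] := phi_surj z.
  rewrite rootE !hornerE -rmorphXn -rmorphB phi_eq0 /=.
  rewrite expr_card_iterE.
  (* p(Y) - p(X) is a multiple of Y - X *)
  rewrite -[X in _ - X]comp_polyXr.
  elim/poly_ind: (p) => [|p' c IH]; first by rewrite !comp_poly0 subr0 dvdp0.
  rewrite !comp_poly_MXaddC opprD addrACA subrr addr0 !comp_polyXr in IH *.
  have -> : (p' \Po 'X^(q ^ n)) * 'X^(q ^ n) - p' * 'X =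
    ((p' \Po 'X^(q ^ n)) - p') * 'X^(q ^ n) + p' * ('X^(q ^ n) - 'X) by ring.
  by apply: dvdp_add; [apply: dvdp_mulr | apply: dvdp_mull].
have /(_ (enum K)) := max_poly_roots Nz.
rewrite size_polyDl ?size_polyN ?size_polyX ?size_polyXn ?ltnS //.
rewrite enum_uniq -cardE cardK leq_exp2l //; apply=> //.
by apply/allP=> z _; apply: rootK.
Qed.

(** The roots of [g] in its residue field are the conjugates [x ^+ (q ^ i)] of
    the class [x] of ['X], so [g.[c]] is the norm of [c - x], a power of
    [c - x]. *)
Lemma phi_norm (c : F) :
  phi ((c%:P - 'X) ^+ (\sum_(i < (size g).-1) q ^ i)) = phi (g.[c])%:P.
Proof.
set n := (size g).-1; have q1 := finNzRing_gt1 F.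
pose iota_ := (phi \o polyC : {rmorphism F -> K}).
pose x := phi 'X.
have horner_res p : (map_poly iota_ p).[x] = phi p.
  elim/poly_ind: p => [|p a IH]; first by rewrite !rmorph0 horner0.
  by rewrite !rmorphD !rmorphM /= map_polyX map_polyC !hornerE IH.
have horner_frob i p : (map_poly iota_ p).[x ^+ (q ^ i)] = phi p ^+ (q ^ i).
  rewrite -rmorphXn expr_card_iterE.
  by rewrite -horner_res map_comp_poly map_polyXn horner_comp hornerXn.
have frob_inj i : injective (fun z : K => z ^+ (q ^ i)).
  move=> u v; have [p ->] := phi_surj u; have [p' ->] := phi_surj v.
  move/eqP; rewrite /= -!(rmorphXn phi) -subr_eq0 -(rmorphB phi).
  rewrite (expr_card_iterE p) (expr_card_iterE p').
  rewrite -comp_polyB -expr_card_iterE (rmorphXn phi) expf_eq0 rmorphB subr_eq0.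
  by case/andP=> _ /eqP.
pose rs := [seq x ^+ (q ^ i) | i <- index_iota 0 n].
have size_g : size g = n.+1 by rewrite prednK // ltnW ?g_irr.1.
have rs_uniq : uniq rs.
  rewrite map_inj_in_uniq ?iota_uniq // => i j; rewrite !mem_index_iota /=.
  wlog lt_ij : i j / (i < j)%N => [W | i_n j_n].
    case: (ltngtP i j) => // lt_ij i_n j_n Eij; last exact/esym/W.
    exact: W.
  move=> Eij; have : x ^+ (q ^ (j - i)) = x.
    by apply: (frob_inj i); rewrite -exprM -expnD subnK // ltnW.
  move/eqP; rewrite -subr_eq0 -rmorphXn -rmorphB phi_eq0.
  move/size_le_frobenius_fixed; rewrite subn_gt0 lt_ij => /(_ isT).
  by rewrite -/n leqNgt ltn_subLR ?(ltnW lt_ij) // ltn_addl.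
have g_split : map_poly iota_ g = \prod_(z <- rs) ('X - z%:P).
  rewrite [LHS](@all_roots_prod_XsubC _ _ rs).
  - by rewrite lead_coef_map (eqP g_mon) rmorph1 scale1r.
  - by rewrite size_map_poly size_map size_iota subn0.
  - apply/allP => _ /mapP[i _ ->]; rewrite rootE horner_frob.
    by rewrite expf_eq0 phi_eq0 dvdpp andbT expn_gt0 ltnW.
  - by rewrite uniq_rootsE.
have -> : phi (g.[c])%:P = (map_poly iota_ g).[iota_ c] by rewrite horner_map.
rewrite g_split horner_prod big_map big_mkord.
rewrite rmorphXn (big_morph (fun k => phi (c%:P - 'X) ^+ k) (exprD _) (expr0 _)).
apply: eq_bigr => i _; rewrite hornerXsubC -(rmorphXn phi).
by rewrite expr_card_iterE comp_polyB comp_polyC comp_polyX rmorphB rmorphXn.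
Qed.

End Quotient.

Lemma euler_criterion (x : F) : odd q -> x != 0 -> x ^+ q./2 = 1 \/ x ^+ q./2 = -1.
Proof.
move=> q_odd x_neq0; apply/pred2P; rewrite -eqf_sqr expr1n -exprM.
apply/eqP/(mulfI x_neq0); rewrite -exprS muln2.
by have := odd_double_half q; rewrite q_odd add1n mulr1 => ->; apply: expf_card.
Qed.

(** If [g.[c]] were a square, then every root of [g \Po f], for
    [f := ('X - b) ^+ 2 + c], would lie in the field generated by a root of
    [g], because the norm of [c - x] would be a square. *)
Lemma irreducible_comp_nonsquare (g : {poly F}) (b c : F) :
    odd q -> irreducible_poly g -> g \is monic -> ~~ odd (size g).-1 ->
    irreducible_poly (g \Po (('X - b%:P) ^+ 2 + c%:P)) ->
  g.[c] ^+ q./2 = -1.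
Proof.
set f := _ + c%:P; set n := (size g).-1.
move=> q_odd g_irr g_mon n_even gf_irr.
have n_gt0 : (0 < n)%N by rewrite -ltnS prednK ?g_irr.1 // ltnW ?g_irr.1.
have n_gt1 : (1 < n)%N by case: (n) n_gt0 n_even => [|[]].
have q_gt0 : (0 < q)%N by apply/ltnW/finNzRing_gt1.
have size_f : size f = 3.
  by rewrite size_polyDl size_exp_XsubC // size_polyC; case: eqP.
have gc_neq0 : g.[c] != 0.
  apply/negP; rewrite -[_ == 0]/(root g c) -dvdp_XsubCl => /(g_irr.2 _).
  rewrite size_XsubC => /(_ isT) /eqp_size; rewrite size_XsubC => size_g.
  by move: n_gt1; rewrite /n -size_g.
have [gc1|//] := euler_criterion q_odd gc_neq0.
have [K [phi [phi_surj phi_eq0 cardK]]] := residue_field g_irr g_mon.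
have := phi_norm g_irr g_mon phi_surj phi_eq0 cardK c.
rewrite -/n; set S := (\sum_(i < n) _)%N => normE.
have q_half : (q.-1 = q./2 * 2)%N.
  by rewrite -[in LHS](odd_double_half q) q_odd add1n muln2.
(* [S] is the exponent (q ^ n - 1) / (q - 1) of the norm. *)
have S_card : (S * q./2 * 2 = (q ^ n).-1)%N.
  by rewrite predn_exp -mulnA -q_half mulnC.
have S_even : ~~ odd S.
  have -> : odd S = odd n.
    rewrite /S; elim: (n) => [|k IH]; first by rewrite big_ord0.
    by rewrite big_ord_recr oddD IH oddX q_odd orbT addbT.
  by [].
have g_dvd : g %| (c%:P - 'X) ^+ (S * q./2) - 1.
  rewrite -phi_eq0 rmorphB rmorph1 exprM (rmorphXn phi) normE -(rmorphXn phi).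
  by rewrite -polyC_exp gc1 rmorph1 subrr.
have gf_dvd : g \Po f %| 'X^(q ^ n) - 'X.
  have /dvdpP[h hE] := g_dvd.
  have -> : 'X^(q ^ n) - 'X =
      (((c%:P - 'X) ^+ (S * q./2) - 1) \Po f) * ('X - b%:P) :> {poly F}.
    rewrite comp_polyB rmorphXn /= comp_polyB !comp_polyC comp_polyX.
    have -> : c%:P - f = - ('X - b%:P) ^+ 2 by rewrite /f; ring.
    rewrite exprNn -exprM.
    rewrite -signr_odd oddM (negPf S_even) mul1r (mulnC 2) S_card.
    rewrite mulrBl mul1r -exprSr prednK ?expn_gt0 ?q_gt0 //.
    rewrite (expr_card_iterE ('X - _)) comp_polyB comp_polyC comp_polyX; ring.
  by rewrite hE comp_polyM -mulrA mulrCA dvdp_mulr.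
have gf_mon : g \Po f \is monic.
  rewrite monicE lead_coef_comp ?size_f // (eqP g_mon) mul1r.
  rewrite lead_coefDl ?size_exp_XsubC ?size_polyC; last by case: eqP.
  by rewrite lead_coef_exp lead_coefXsubC !expr1n.
have [K' [phi' [phi_surj' phi_eq0' cardK']]] := residue_field gf_irr gf_mon.
have := size_le_frobenius_fixed phi_surj' phi_eq0' cardK' n_gt0 gf_dvd.
by rewrite size_comp_poly -/n size_f /= leqNgt ltn_Pmulr.
Qed.

End ResidueField.

(** * Free composition of two quadratic polynomials *)

Section WordComposition.

Variables (F : finFieldType) (r : nat) (f : 'I_r -> {poly F}) (b c : 'I_r -> F).
Hypothesis f_def : forall i, f i = ('X - (b i)%:P) ^+ 2 + (c i)%:P.

Lemma word_comp_cons i s :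
  word_comp f (i :: s) = (word_comp f s - (b i)%:P) ^+ 2 + (c i)%:P.
Proof.
by rewrite /= f_def comp_polyD rmorphXn /= comp_polyB comp_polyX !comp_polyC.
Qed.

Lemma word_comp_cat s t : word_comp f (s ++ t) = word_comp f s \Po word_comp f t.
Proof. by elim: s => [|i s IH] /=; rewrite ?comp_polyX // IH comp_polyA. Qed.

Lemma size_word_comp s : size (word_comp f s) = (2 ^ size s).+1.
Proof.
have size_f i : size (f i) = 3.
  by rewrite f_def size_polyDl size_exp_XsubC // size_polyC; case: eqP.
elim: s => [|i s IH]; first by rewrite size_polyX.
have E : (size (word_comp f (i :: s))).-1 = (2 ^ (size s).+1)%N.
  by rewrite /= size_comp_poly IH size_f /= expnS.
rewrite [size (i :: s)]/= -E prednK // lt0n; apply/eqP=> W0.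
by move/esym/eqP: E; rewrite W0 expn_eq0.
Qed.

Lemma monic_word_comp s : word_comp f s \is monic.
Proof.
elim: s => [|i s IH]; first exact: monicX.
have f_mon : f i \is monic.
  rewrite f_def monicE lead_coefDl ?size_exp_XsubC ?size_polyC; last by case: eqP.
  by rewrite lead_coef_exp lead_coefXsubC !expr1n.
rewrite monicE /= lead_coef_comp ?size_word_comp ?ltnS ?expn_gt0 //.
by rewrite (eqP f_mon) (eqP IH) expr1n mulr1.
Qed.

Hypothesis F2 : 2%:R != 0 :> F.

(** In odd characteristic, if the squares of two monic polynomials of the same
    positive degree differ by a constant, then the polynomials are equal: the
    difference of the squares factors, and one of the factors has positive
    degree. *)
Lemma quadratic_comp_eq (P P' : {poly F}) b1 b2 c1 c2 d :
    P \is monic -> P' \is monic -> size P' = size P -> (1 < size P)%N ->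
    (P - b1%:P) ^+ 2 + c1%:P - ((P' - b2%:P) ^+ 2 + c2%:P) = d%:P ->
  P - P' = (b1 - b2)%:P /\ d = c1 - c2.
Proof.
move=> P_mon P'_mon sizeE P_gt1 dE.
pose D := P - P' - (b1 - b2)%:P; pose S := P + P' - (b1 + b2)%:P.
have DS : D * S = (d - c1 + c2)%:P.
  by rewrite polyCD polyCB -dE /D /S polyCB polyCD; ring.
have coefS : S`_(size P).-1 = 2%:R.
  rewrite !coefB !coefD coefC -[P`__]/(lead_coef P) -[in P'`__]sizeE.
  rewrite -[P'`__]/(lead_coef P') (eqP P_mon) (eqP P'_mon).
  by case: (size P) P_gt1 => [|[]] //= n _; rewrite subr0.
have sizeS : (1 < size S)%N.
  rewrite ltnNge; apply/negP => /leq_sizeP/(_ (size P).-1).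
  rewrite coefS => E; move: F2; rewrite E ?eqxx //.
  by case: (size P) P_gt1 => [|[]].
have D0 : D = 0.
  apply/eqP; apply: contraLR sizeS => D_neq0; rewrite -leqNgt.
  have [->|S_neq0] := eqVneq S 0; first by rewrite size_poly0.
  have := size_mul D_neq0 S_neq0; rewrite DS => E.
  have : (size ((d - c1 + c2)%:P : {poly F}) <= 1)%N by apply: size_polyC_leq1.
  have : (0 < size D)%N by rewrite size_poly_gt0.
  rewrite E; case: (size D) => // k _; rewrite addSn /=.
  exact/leq_trans/leq_addl.
split; first by apply/subr0_eq.
have /eqP := DS; rewrite D0 mul0r eq_sym polyC_eq0 => /eqP E.
by apply/subr0_eq; rewrite -E; ring.
Qed.

(** The polynomials [f i0] and [f i1] freely generate a monoid under
    composition.  If the first letters of two words with equal values differ,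
    then [c i0 = c i1] and the values of the tails differ by a constant, which
    vanishes by [quadratic_comp_eq] applied to the tails. *)
Lemma word_comp_inj i0 i1 (s t : seq 'I_r) :
    f i0 != f i1 ->
    all (pred2 i0 i1) s -> all (pred2 i0 i1) t -> size s = size t ->
  word_comp f s = word_comp f t -> s = t.
Proof.
move=> fne; elim: s t => [|i s IH] [|j t] //= /andP[i_in s_in] /andP[j_in t_in].
move=> [size_st] E.
have step i' j' s' t' d : size s' = size t' ->
    word_comp f (i' :: s') - word_comp f (j' :: t') = d%:P ->
  word_comp f s' - word_comp f t' = (b i' - b j')%:P /\ d = c i' - c j'.
  move=> size_st'; rewrite !word_comp_cons; apply: quadratic_comp_eq.
  - exact: monic_word_comp.
  - exact: monic_word_comp.
  - by rewrite !size_word_comp size_st'.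
  - by rewrite size_word_comp ltnS expn_gt0.
have [||E1 c0] := step i j s t 0; rewrite ?polyC0 //=; first by rewrite E subrr.
have [ij|ij] := eqVneq i j.
  by rewrite -ij (IH t) //; apply/subr0_eq; rewrite E1 ij subrr.
have cE k l : k \in pred2 i0 i1 -> l \in pred2 i0 i1 -> c k = c l.
  have cij : c i = c j by apply/subr0_eq.
  have c01 : c i0 = c i1.
    by case/pred2P: i_in ij cij => ->; case/pred2P: j_in => ->; rewrite ?eqxx.
  by move=> /pred2P[] -> /pred2P[] ->.
have bij : b i = b j.
  case: s t {IH E c0} E1 size_st s_in t_in => [|k s] [|l t] // E1 size_st.
    by move=> _ _; apply/subr0_eq/polyC_inj; rewrite -E1 subrr.
  move=> /= /andP[k_in _] /andP[l_in _].
  have size_st2 : size s = size t by case: size_st.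
  have [_ E2] := step k l s t _ size_st2 E1.
  by apply/subr0_eq; rewrite E2 (cE k l) // subrr.
case/negP: fne.
have : f i = f j by rewrite !f_def bij (cE i j).
by case/pred2P: i_in ij => ->; case/pred2P: j_in => -> //; rewrite ?eqxx // => _ ->.
Qed.

End WordComposition.

(** * Products of distinct irreducible polynomials *)

Section NonSquare.

Variable F : fieldType.

(** A product with a simple irreducible factor [p] is not a constant times the
    square of a rational function: by infinite descent, [p] divides [k], then
    [h]. *)
Lemma irreducible_factor_nonsquare (p g h k : {poly F}) (a : F) :
    irreducible_poly p -> coprimep p g -> h ^+ 2 * (p * g) = a *: k ^+ 2 ->
  h = 0.
Proof.
move=> p_irr pg_co; have [n] := ubnP (size h).
elim: n h k => // n IH h k le_h E; apply/eqP/negPn/negP => h_neq0.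
have p_neq0 := irredp_neq0 p_irr.
have a_neq0 : a != 0.
  apply: contra_eq_neq E => ->; rewrite scale0r !mulf_neq0 ?expf_neq0 //.
  by apply: contraL pg_co => /eqP ->; rewrite coprimep0 -size_poly_eq1 gtn_eqF ?p_irr.1.
have p_dvd_sqr (u : {poly F}) : p %| u ^+ 2 -> p %| u.
  rewrite expr2; have [//|pu] := boolP (p %| u).
  by rewrite Gauss_dvdpr ?irreducible_poly_coprime // (negPf pu).
have /dvdpP[k' kE] : p %| k.
  by apply: p_dvd_sqr; rewrite -(dvdpZr _ _ a_neq0) -E mulrCA dvdp_mulr.
have hgE : h ^+ 2 * g = p * (a *: k' ^+ 2).
  by apply: (mulfI p_neq0); rewrite mulrCA E kE -!mul_polyC; ring.
have /dvdpP[h' hE] : p %| h.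
  by apply: p_dvd_sqr; rewrite -(Gauss_dvdpl _ pg_co) hgE dvdp_mulr.
have h'_neq0 : h' != 0 by apply: contra_neq h_neq0 => h0; rewrite hE h0 mul0r.
case/eqP: (h'_neq0); apply: (IH h' k').
  move: le_h; rewrite hE size_mul // ltnS; apply: leq_trans.
  by case: (size p) p_irr.1 => [|[|m]] // _; rewrite !addnS ltnS leq_addr.
by apply: (mulfI p_neq0); rewrite -hgE hE; ring.
Qed.

Lemma prod_irreducible_nonsquare (I : finType) (S : {set I}) (G : I -> {poly F})
    (h k : {poly F}) (a : F) :
    {in S &, injective G} -> {in S, forall i, irreducible_poly (G i)} ->
    {in S, forall i, G i \is monic} -> S != set0 ->
    h ^+ 2 * (\prod_(i in S) G i) = a *: k ^+ 2 ->
  h = 0.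
Proof.
move=> G_inj G_irr G_mon /set0Pn[i0 i0S]; rewrite (bigD1 i0) //=.
apply: irreducible_factor_nonsquare; first exact: G_irr.
rewrite irreducible_poly_coprime; last exact: G_irr.
elim/big_ind: _ => [|u v|j /andP[jS j_neq]].
- by rewrite dvdp1 gtn_eqF ?(G_irr _ i0S).1.
- rewrite -!irreducible_poly_coprime ?coprimepMr; try exact: G_irr.
  by move=> -> ->.
apply/negP => /((G_irr j jS).2 _); rewrite gtn_eqF ?(G_irr _ i0S).1 // => /(_ isT).
rewrite eqp_monic ?G_mon // => /eqP /G_inj E; case/eqP: j_neq; exact/esym/E.
Qed.

End NonSquare.

(** * Hasse derivatives *)

Section HasseDerivative.

(** Leibniz formula for Hasse derivatives. *)
Lemma nderivnM (R : comNzRingType) (p p' : {poly R}) n :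
  (p * p')^`N(n) = \sum_(i < n.+1) p^`N(i) * p'^`N(n - i).
Proof.
elim/poly_ind: p n => [|p c IH] n.
  rewrite mul0r linear0 big1 // => i _; by rewrite linear0 mul0r.
have -> : (p * 'X + c%:P) * p' = (p * p') * 'X + 0%:P + c *: p'.
  by rewrite polyC0 -mul_polyC; ring.
case: n => [|n].
  by rewrite big_ord1 !nderivn0 polyC0 -mul_polyC; ring.
rewrite nderivnD nderivnMXaddC nderivnZ !IH [RHS]big_ord_recl nderivn0 subn0.
have -> : \sum_(i < n.+1) (p * 'X + c%:P)^`N(lift ord0 i)
      * p'^`N(n.+1 - lift ord0 i) =
    \sum_(i < n.+1) p^`N(i) * p'^`N(n - i)
      + (\sum_(i < n.+1) p^`N(i.+1) * p'^`N(n - i)) * 'X.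
  rewrite mulr_suml -big_split; apply: eq_bigr => i _ /=.
  by rewrite /bump add1n subSS nderivnMXaddC; ring.
rewrite [\sum_(i < n.+2) _]big_ord_recl nderivn0 subn0 -mul_polyC.
under [\sum_(i < n.+1) p^`N(lift ord0 i) * _]eq_bigr => i _ do
  rewrite lift0 subSS.
ring.
Qed.

Lemma dvdp_nderivn_exp (F : fieldType) (g k : {poly F}) n i :
  g ^+ (n - i) %| (g ^+ n * k)^`N(i).
Proof.
elim: n i => [|n IH] i; first by rewrite sub0n dvd1p.
rewrite exprS -mulrA nderivnM; elim/big_ind: _ => [||j _].
- exact: dvdp0.
- by move=> u v; apply: dvdp_add.
case: j => [[|j] j_lt] /=.
  rewrite nderivn0 subn0; apply: (@dvdp_trans _ (g ^+ (n - i).+1)).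
    by rewrite dvdp_exp2l //; lia.
  by rewrite exprS dvdp_mul.
apply: (@dvdp_trans _ (g ^+ (n - (i - j.+1)))); last by rewrite dvdp_mull.
by rewrite dvdp_exp2l //; lia.
Qed.

Lemma dvdp_XsubC_exp_nderivn (F : fieldType) (p : {poly F}) x n :
  (forall i, (i < n)%N -> (p^`N(i)).[x] = 0) -> ('X - x%:P) ^+ n %| p.
Proof.
move=> p0; have := @nderiv_taylor _ (map_poly polyC p) x%:P ('X - x%:P).
rewrite (addrC x%:P) subrK -[_.['X]]/(p \Po 'X) comp_polyXr => ->; last first.
  exact: mulrC.
elim/big_ind: _ => [||i _]; [exact: dvdp0 | by move=> u v; apply: dvdp_add |].
rewrite nderivn_map horner_map /=; have [i_lt|i_ge] := ltnP i n.
  by rewrite p0 // mul0r dvdp0.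
by rewrite dvdp_mull // dvdp_exp2l.
Qed.

End HasseDerivative.

(** * Stepanov's method for [y ^ 2 = g (x)] *)

Section Stepanov.

Variable F : finFieldType.
Local Notation q := #|F|.
Local Notation M := q./2.

Lemma pigeonhole (U V : finType) (Phi : U -> V) :
  (#|V| < #|U|)%N -> exists u v, u != v /\ Phi u = Phi v.
Proof.
move=> ltVU; have : ~~ injectiveb Phi.
  by apply: contraL ltVU => /injectiveP /leq_card; rewrite -leqNgt.
by case/injectivePn => u [v uv E]; exists u, v.
Qed.

Lemma prod_XsubC_exp_dvdp (p : {poly F}) (T : {set F}) l :
    {in T, forall x, ('X - x%:P) ^+ l %| p} ->
  \prod_(x in T) ('X - x%:P) ^+ l %| p.
Proof.
move=> T_dvd; rewrite -big_enum.
have : {in enum T, forall x, ('X - x%:P) ^+ l %| p}.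
  by move=> x; rewrite mem_enum; apply: T_dvd.
have := enum_uniq T; elim: (enum T) => [|x s IH]; first by rewrite big_nil dvd1p.
move=> /= /andP[x_s s_uniq] s_dvd; rewrite big_cons Gauss_dvdp.
  rewrite s_dvd ?mem_head ?IH // => y y_s.
  by apply: s_dvd; rewrite in_cons y_s orbT.
rewrite prodrXl coprimep_expl // coprimep_expr // coprimep_sym coprimep_XsubC.
by rewrite root_prod_XsubC.
Qed.

Variable g : {poly F}.
Local Notation d := (size g).-1.
Hypothesis q_odd : odd q.
Hypothesis g_noroot : forall x, g.[x] != 0.
Hypothesis g_nonsquare :
  forall a (h k : {poly F}), h ^+ 2 * g = a *: k ^+ 2 -> h = 0.

Let g_neq0 : g != 0.
Proof. by apply: contraNneq (g_noroot 0) => ->; rewrite horner0. Qed.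

Let q_half : q = (M * 2).+1.
Proof. by rewrite -[LHS]odd_double_half q_odd muln2. Qed.

Let size_g : size g = d.+1.
Proof. by rewrite prednK // size_poly_gt0. Qed.

Let size_gexp n : size (g ^+ n) = (n * d).+1.
Proof.
by rewrite -[LHS]prednK ?size_poly_gt0 ?expf_neq0 // size_exp mulnC.
Qed.

(** Squaring [a = - b * g ^+ M] and multiplying by [g] gives
    [a ^+ 2 * g = b ^+ 2 * g ^+ q], and [g ^+ q] is congruent to [g.[0]] modulo
    ['X^q].  The degree condition turns the resulting congruence between
    [k0 ^+ 2 * g] and [g.[0] *: k1 ^+ 2] into an equality. *)
Lemma aux_head_eq0 A (k0 k1 R0 R1 : {poly F}) :
    (2 * A + d <= q.+1)%N -> (size k0 <= A)%N -> (size k1 <= A)%N ->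
    (k0 + 'X^q * R0) + (k1 + 'X^q * R1) * g ^+ M = 0 ->
  k0 = 0 /\ k1 = 0.
Proof.
move=> leA.
have [->|A_gt0] := posnP A.
  by rewrite !leqn0 !size_poly_eq0 => /eqP -> /eqP ->.
move=> k0_A k1_A E.
have [G GE] : exists G, g ^+ q = (g.[0])%:P + 'X^q * G.
  rewrite expr_cardE.
  elim/poly_ind: (g) => [|p c _]; first by exists 0; rewrite horner0 comp_poly0; ring.
  exists (p \Po 'X^q); rewrite comp_poly_MXaddC hornerMXaddC mulr0 add0r; ring.
have key : k0 ^+ 2 * g - g.[0] *: k1 ^+ 2 = 0.
  have sqr_le (k : {poly F}) : (size k <= A)%N -> (size (k ^+ 2)%R <= (2 * A).-1)%N.
    move=> kA; rewrite expr2 (leq_trans (size_polyMleq _ _)) //.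
    by rewrite -!subn1 leq_sub2r // mul2n -addnn leq_add.
  apply/eqP/negPn/negP => nz.
  have : 'X^q %| k0 ^+ 2 * g - g.[0] *: k1 ^+ 2.
    set a := k0 + _ in E; set b := k1 + _ in E.
    have abE : a ^+ 2 * g = b ^+ 2 * g ^+ q.
      have -> : g ^+ q = g * (g ^+ M) ^+ 2 by rewrite [in LHS]q_half exprS exprM.
      have -> : a = - (b * g ^+ M) by apply/eqP; rewrite -addr_eq0 E.
      ring.
    apply/dvdpP; exists (G * k1 ^+ 2 + (2 * b * R1 - 'X^q * R1 ^+ 2) * g ^+ q
      - (2 * a * R0 - 'X^q * R0 ^+ 2) * g).
    rewrite -mul_polyC (_ : (g.[0])%:P = g ^+ q - 'X^q * G); last by rewrite GE; ring.
    rewrite (_ : k0 = a - 'X^q * R0); last by rewrite /a; ring.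
    rewrite (_ : k1 = b - 'X^q * R1); last by rewrite /b; ring.
    by apply/subr0_eq; rewrite -(subrr (a ^+ 2 * g)) {2}abE; ring.
  move/(dvdp_leq nz); rewrite size_polyXn; apply/negP; rewrite -ltnNge ltnS.
  have le1 : (size (k0 ^+ 2 * g)%R <= q)%N.
    apply: (leq_trans (size_polyMleq _ _)); rewrite size_g addnS /=.
    move: (sqr_le _ k0_A) leA A_gt0.
    by move: (size (k0 ^+ 2)%R) (size g).-1 #|F| => m d' Q; lia.
  apply: (leq_trans (size_polyD _ _)); rewrite geq_max le1 size_polyN /=.
  apply: (leq_trans (size_scale_leq _ _)); apply: (leq_trans (sqr_le _ k1_A)).
  by move: leA A_gt0; move: (size g).-1 #|F| => d' Q; lia.
have k00 : k0 = 0 by apply: (@g_nonsquare g.[0] k0 k1); apply/subr0_eq.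
split=> //; move/eqP: key; rewrite k00 expr0n mul0r sub0r oppr_eq0 scaler_eq0.
by rewrite (negPf (g_noroot 0)) expf_eq0 /= => /eqP.
Qed.

(** The auxiliary polynomial is zero only if all its coefficients are. *)
Lemma aux_eq0 A J (k0 k1 : nat -> {poly F}) :
    (2 * A + d <= q.+1)%N ->
    (forall j, (size (k0 j) <= A)%N) -> (forall j, (size (k1 j) <= A)%N) ->
    (\sum_(j < J) k0 j * 'X^(q * j)) + (\sum_(j < J) k1 j * 'X^(q * j)) * g ^+ M
      = 0 ->
  forall j, (j < J)%N -> k0 j = 0 /\ k1 j = 0.
Proof.
move=> leA; elim: J k0 k1 => // J IH k0 k1 k0_A k1_A.
have recl (k : nat -> {poly F}) : \sum_(j < J.+1) k j * 'X^(q * j) =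
    k 0 + 'X^q * \sum_(j < J) k j.+1 * 'X^(q * j).
  rewrite big_ord_recl muln0 expr0 mulr1 mulr_sumr; congr (_ + _).
  by apply: eq_bigr => j _; rewrite lift0 mulnS exprD; ring.
rewrite !recl => E; have [k00 k10] := aux_head_eq0 leA (k0_A 0) (k1_A 0) E.
case=> [|j] // j_lt; apply: (IH (k0 \o succn) (k1 \o succn)) => //=.
apply: (@mulfI _ ('X^q)); first by rewrite expf_neq0 ?polyX_eq0.
by rewrite mulr0 -[RHS]E k00 k10; ring.
Qed.

(** Let [x] satisfy [g.[x] ^+ M = e].  Modulo ['X^q - x%:P], the auxiliary
    polynomial [aux_poly] below is congruent to the polynomial obtained by
    replacing ['X^(q * j)] with the scalar [x ^+ j].  The Hasse derivative of
    order [i] of the latter takes at [x] the value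
    [g.[x] ^+ (l - i) * (deriv_cond e l J k0 k1 i).[x]].  The quotients are
    exact by [dvdp_nderivn_exp]. *)
Definition deriv_cond (e : F) l J (k0 k1 : nat -> {poly F}) i : {poly F} :=
  \sum_(j < J) ((g ^+ l * k0 j)^`N(i) %/ g ^+ (l - i)
      + e *: ((g ^+ (l + M) * k1 j)^`N(i) %/ g ^+ (l + M - i))) * 'X^j.

Lemma size_deriv_cond e l A J (k0 k1 : nat -> {poly F}) i :
    (forall j, (size (k0 j) <= A)%N) -> (forall j, (size (k1 j) <= A)%N) ->
    (i < l)%N ->
  (size (deriv_cond e l J k0 k1 i) <= A + l * d + J)%N.
Proof.
move=> k0_A k1_A il.
have size_quo n (k : {poly F}) : (i <= n)%N -> (size k <= A)%N ->
    (size ((g ^+ n * k)^`N(i) %/ g ^+ (n - i))%R <= A + l * d)%N.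
  move=> i_n kA; rewrite size_divp ?expf_neq0 // size_gexp /=.
  have : (size ((g ^+ n * k)^`N(i))%R <= n * d + A)%N.
    apply: (leq_trans (size_poly _ _)); apply: (leq_trans (leq_subr _ _)).
    apply: (leq_trans (size_polyMleq _ _)); rewrite size_gexp addSn /=.
    by rewrite leq_add2l.
  move=> le; rewrite leq_subLR; apply: (leq_trans le).
  rewrite addnCA addnC leq_add2l -mulnDl leq_mul2r; apply/orP; right; lia.
apply: (leq_trans (size_sum _ _ _)); apply/bigmax_leqP => j _.
apply: (leq_trans (size_polyMleq _ _)); rewrite size_polyXn addnS /=.
apply: leq_add; last exact: ltnW.
apply: (leq_trans (size_polyD _ _)); rewrite geq_max size_quo ?(ltnW il) //=.
apply: (leq_trans (size_scale_leq _ _)); apply: size_quo => //.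
by rewrite (leq_trans (ltnW il)) ?leq_addr.
Qed.

Lemma deriv_condB e l J (k0 k1 h0 h1 : nat -> {poly F}) i :
  deriv_cond e l J (fun j => k0 j - h0 j) (fun j => k1 j - h1 j) i =
    deriv_cond e l J k0 k1 i - deriv_cond e l J h0 h1 i.
Proof.
rewrite /deriv_cond -sumrB; apply: eq_bigr => j _.
rewrite -mulrBl; congr (_ * _); rewrite !mulrBr !nderivnB !divpD !divpN scalerDr.
by rewrite scalerN opprD; rewrite addrACA.
Qed.

(** The auxiliary polynomial of Stepanov's method. *)
Definition aux_poly l J (k0 k1 : nat -> {poly F}) : {poly F} :=
  g ^+ l * (\sum_(j < J) k0 j * 'X^(q * j)
    + (\sum_(j < J) k1 j * 'X^(q * j)) * g ^+ M).

Lemma dvdp_aux_poly e l J (k0 k1 : nat -> {poly F}) x :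
    (l <= q)%N -> (forall i, (i < l)%N -> deriv_cond e l J k0 k1 i = 0) ->
    g.[x] ^+ M = e ->
  ('X - x%:P) ^+ l %| aux_poly l J k0 k1.
Proof.
move=> lq cond0 gx.
pose Px := \sum_(j < J) x ^+ j *: (g ^+ l * k0 j + g ^+ (l + M) * k1 j).
have Px_dvd : ('X - x%:P) ^+ l %| Px.
  apply: dvdp_XsubC_exp_nderivn => i il.
  have : (g ^+ (l - i) * deriv_cond e l J k0 k1 i).[x] = 0.
    by rewrite cond0 ?mulr0 ?horner0.
  move <-; rewrite /Px linear_sum /= mulr_sumr !horner_sum; apply: eq_bigr => j _.
  have divK n (k : {poly F}) : (g ^+ n * k)^`N(i) =
      ((g ^+ n * k)^`N(i) %/ g ^+ (n - i)) * g ^+ (n - i).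
    by rewrite divpK // dvdp_nderivn_exp.
  rewrite nderivnZ nderivnD hornerZ hornerD [in LHS](divK l) [in LHS](divK (l + M)%N).
  rewrite -addnBAC ?(ltnW il) // (exprD _ (l - i)) !hornerM !hornerD hornerXn hornerZ.
  rewrite !horner_exp gx; ring.
rewrite -[aux_poly _ _ _ _](subrK Px) dvdp_add //.
have -> : aux_poly l J k0 k1 - Px = \sum_(j < J)
    (g ^+ l * k0 j + g ^+ (l + M) * k1 j) * ('X^(q * j) - (x ^+ j)%:P).
  rewrite /aux_poly mulrDr mulr_suml !mulr_sumr -big_split -sumrB.
  by apply: eq_bigr => j _ /=; rewrite exprD -mul_polyC; ring.
elim/big_ind: _ => [||j _]; [exact: dvdp0 | by move=> u v; apply: dvdp_add |].
apply: dvdp_mull; rewrite exprM polyC_exp subrXX dvdp_mulr //.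
have -> : 'X^q - x%:P = ('X - x%:P) ^+ q :> {poly F}.
  by rewrite [RHS]expr_cardE comp_polyB comp_polyX comp_polyC.
by rewrite dvdp_exp2l.
Qed.

Lemma size_aux_poly l A J (k0 k1 : nat -> {poly F}) :
    (0 < J)%N ->
    (forall j, (size (k0 j) <= A)%N) -> (forall j, (size (k1 j) <= A)%N) ->
  (size (aux_poly l J k0 k1) <= (l + M) * d + A + q * J.-1)%N.
Proof.
move=> J0 k0_A k1_A.
have sum_le (k : nat -> {poly F}) : (forall j, (size (k j) <= A)%N) ->
    (size (\sum_(j < J) k j * 'X^(q * j))%R <= A + q * J.-1)%N.
  move=> kA; apply: (leq_trans (size_sum _ _ _)); apply/bigmax_leqP => j _.
  apply: (leq_trans (size_polyMleq _ _)); rewrite size_polyXn addnS /=.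
  by rewrite leq_add // leq_mul2l -ltnS prednK // ltn_ord orbT.
apply: (leq_trans (size_polyMleq _ _)); rewrite size_gexp addSn /=.
rewrite mulnDl -!addnA leq_add2l.
apply: (leq_trans (size_polyD _ _)); rewrite geq_max; apply/andP; split.
  by apply: (leq_trans (sum_le _ k0_A)); rewrite leq_addl.
apply: (leq_trans (size_polyMleq _ _)); rewrite size_gexp addnS /= addnC.
by rewrite leq_add2l sum_le.
Qed.

(** There are [2 * J * A] free coefficients in [aux_poly] and fewer than that
    linear conditions, so some nonzero choice makes [aux_poly] vanish to order
    [l] at all the points of the set. *)
Lemma stepanov e l A J :
    (0 < J)%N -> (l <= q)%N -> (2 * A + d <= q.+1)%N ->
    (l * (A + l * d + J) < 2 * J * A)%N ->
  (#|[set x | g.[x] ^+ M == e]| * l < (l + M) * d + A + q * J.-1)%N.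
Proof.
move=> J0 lq leA count; set T := [set x | _].
pose B := (A + l * d + J)%N.
(* The finitely many polynomials of a vector of coefficients, extended by [0]. *)
pose kap (u : {ffun 'I_J -> {poly_A F}}) j : {poly F} :=
  if insub j is Some j' then (u j' : {poly F}) else 0.
have kapA u j : (size (kap u j) <= A)%N.
  by rewrite /kap; case: insub => [j'|]; rewrite ?size_npoly ?size_poly0.
pose U := ({ffun 'I_J -> {poly_A F}} * {ffun 'I_J -> {poly_A F}})%type.
pose Phi (u : U) : {ffun 'I_l -> {poly_B F}} :=
  [ffun i : 'I_l => npolyp B (deriv_cond e l J (kap u.1) (kap u.2) i)].
have [|u [v [uv E]]] := @pigeonhole _ _ Phi.
  rewrite card_prod !card_ffun !card_npoly !card_ord -!expnM -expnD.
  by rewrite ltn_exp2l ?finNzRing_gt1 //; lia.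
pose k0 j := kap u.1 j - kap v.1 j; pose k1 j := kap u.2 j - kap v.2 j.
have k0A j : (size (k0 j) <= A)%N.
  by rewrite (leq_trans (size_polyD _ _)) // size_polyN geq_max !kapA.
have k1A j : (size (k1 j) <= A)%N.
  by rewrite (leq_trans (size_polyD _ _)) // size_polyN geq_max !kapA.
have cond0 i : (i < l)%N -> deriv_cond e l J k0 k1 i = 0.
  move=> il; have /(congr1 (fun w : {ffun 'I_l -> {poly_B F}} =>
    (w (Ordinal il) : {poly F}))) := E.
  rewrite !ffunE !npolypK ?size_deriv_cond // => E'.
  by rewrite deriv_condB E' subrr.
have P_neq0 : aux_poly l J k0 k1 != 0.
  rewrite mulf_neq0 ?expf_neq0 //; apply: contra_neq uv => E0.
  have k_eq0 := aux_eq0 leA k0A k1A E0.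
  have kapE (w : {ffun 'I_J -> {poly_A F}}) (j : 'I_J) : kap w j = w j.
    by rewrite /kap valK.
  rewrite [u]surjective_pairing [v]surjective_pairing.
  by congr pair; apply/ffunP => j; apply/val_inj; rewrite /= -!kapE;
    apply/subr0_eq; have [] := k_eq0 j (ltn_ord j).
have T_dvd : \prod_(x in T) ('X - x%:P) ^+ l %| aux_poly l J k0 k1.
  apply: prod_XsubC_exp_dvdp => x; rewrite inE => /eqP.
  exact: dvdp_aux_poly.
have := dvdp_leq P_neq0 T_dvd; rewrite prodrXl => le1.
apply: leq_trans (leq_trans le1 (size_aux_poly l J0 k0A k1A)).
have prod_neq0 : \prod_(x in T) ('X - x%:P) != 0 :> {poly F}.
  by apply/prodf_neq0 => x _; rewrite polyXsubC_eq0.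
rewrite -[ltnRHS]prednK ?ltnS ?size_poly_gt0 ?expf_neq0 // size_exp.
by rewrite -big_enum size_prod_XsubC -cardE.
Qed.

End Stepanov.

(** * Character sums *)

(** A bound on the sum over [F] of the quadratic character of [g], where [d] is
    the degree of [g] and [l] the integer part of the square root of [q]. *)
Definition charsum_bound d l : nat := (3 * d + 3) * (l + 2) + 2 * d.

(** The choice of the parameters in [stepanov]: [A] is the largest value
    allowed, about [(q - d) / 2], and [J] is close to [l / 2 + d + 2], which
    suffices for there to be fewer conditions than coefficients. *)
Lemma stepanov_parameters N d l q :
    (10 <= l)%N -> (2 * d <= l)%N -> (l * l <= q)%N -> (q <= l * (l + 2))%N ->
    odd q ->
    (forall A J, (0 < J)%N -> (l <= q)%N -> (2 * A + d <= q.+1)%N ->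
       (l * (A + l * d + J) < 2 * J * A)%N ->
       (N * l < (l + q./2) * d + A + q * J.-1)%N) ->
  (2 * N <= q + charsum_bound d l)%N.
Proof.
move=> l10 dl lq ql q_odd; set A := (q.+1 - d)./2; set J := (l + 2 * d + 4)./2.
move/(_ A J).
have l_le_sqr : (10 * l <= l * l)%N by rewrite leq_mul2r l10 orbT.
have lq1 : (l <= q)%N by lia.
have A_le : (2 * A <= q.+1 - d)%N.
  by rewrite -[leqRHS](odd_double_half (q.+1 - d)) -/A; lia.
have A_ge : (q - d <= 2 * A)%N.
  have := odd_double_half (q.+1 - d); rewrite -/A; case: (odd _); lia.
have J_le : (2 * J <= l + 2 * d + 4)%N.
  by rewrite -[leqRHS](odd_double_half (l + 2 * d + 4)) -/J; lia.
have J_ge : (l + 2 * d + 3 <= 2 * J)%N.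
  have := odd_double_half (l + 2 * d + 4); rewrite -/J; case: (odd _); lia.
have H_le : (2 * q./2 + 1 = q)%N.
  by rewrite -[RHS](odd_double_half q) q_odd; lia.
move: (q./2) H_le A J A_le A_ge J_le J_ge => H H_le A J A_le A_ge J_le J_ge.
have count : (l * (A + l * d + J) < 2 * J * A)%N.
  have [t tE] : exists t, (2 * A = l + t)%N by exists (2 * A - l)%N; lia.
  have h1 : ((l + 2 * d + 3) * t <= 2 * J * t)%N by rewrite leq_mul2r J_ge orbT.
  have h2 : ((2 * d + 3) * (l * l) <= (2 * d + 3) * (t + d + l))%N.
    by rewrite leq_mul2l; apply/orP; right; lia.
  have h3 : ((2 * d + 3) * (2 * (d + l)) <= (l + 3) * (3 * l))%N.
    by apply: leq_mul; lia.
  suff : (2 * (l * (A + l * d + J)) < 2 * J * (2 * A))%N by lia.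
  have -> : (2 * (l * (A + l * d + J)) = l * (2 * A) + 2 * (l * (l * d)) + 2 * J * l)%N.
    lia.
  rewrite tE; lia.
move=> /(_ _ lq1 _ count) main.
have {}main : (N * l < (l + H) * d + A + q * J.-1)%N by apply: main; lia.
have l_gt0 : (0 < l)%N by lia.
rewrite -(leq_pmul2r l_gt0) /charsum_bound.
have h1 : (q * (2 * J.-1) <= q * (l + 2 * d + 2))%N.
  by rewrite leq_mul2l; apply/orP; right; lia.
have h2 : (q * (3 * d + 3) <= l * (l + 2) * (3 * d + 3))%N.
  by rewrite leq_mul2r ql orbT.
have h3 : (2 * H * d <= q * d)%N by rewrite leq_mul2r -H_le leq_addr orbT.
lia.
Qed.

Section QuadraticCharacter.

Variable F : finFieldType.
Local Notation q := #|F|.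
Local Notation M := q./2.
Hypotheses (F2 : 2%:R != 0 :> F) (q_odd : odd q).

Section OnePolynomial.

Variable g : {poly F}.
Local Notation d := (size g).-1.
Hypothesis g_noroot : forall x, g.[x] != 0.
Hypothesis g_nonsquare :
  forall a (h k : {poly F}), h ^+ 2 * g = a *: k ^+ 2 -> h = 0.

Lemma card_character_fiber e l :
    (10 <= l)%N -> (2 * d <= l)%N -> (l * l <= q)%N -> (q <= l * (l + 2))%N ->
  (2 * #|[set x | g.[x] ^+ M == e]| <= q + charsum_bound d l)%N.
Proof.
move=> l10 dl lq ql; apply: (stepanov_parameters l10 dl lq ql q_odd).
move=> A J J0 lq1 leA count.
exact: (stepanov q_odd g_noroot g_nonsquare e J0 lq1 leA count).
Qed.

End OnePolynomial.

(** The quadratic character of [F], with values in the integers. *)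
Definition qchar (x : F) : int :=
  if x == 0 then 0 else if x ^+ M == 1 then 1 else -1.

Lemma oppr1_neq1 : (-1 : F) != 1.
Proof. by apply: contra_neq F2 => E; rewrite mulr2n -{1}E addNr. Qed.

Lemma qchar1 : qchar 1 = 1.
Proof. by rewrite /qchar oner_eq0 expr1n eqxx. Qed.

Lemma qcharM x y : qchar (x * y) = qchar x * qchar y.
Proof.
rewrite /qchar mulf_eq0; case: eqVneq => [|x0] /=; first by rewrite mul0r.
case: eqVneq => [|y0] /=; first by rewrite mulr0.
rewrite exprMn; have N11 := negPf oppr1_neq1.
by case: (euler_criterion q_odd x0) => ->; case: (euler_criterion q_odd y0) => ->;
  rewrite ?mulrNN ?mul1r ?mulr1 ?eqxx ?N11 ?mulr1.
Qed.

Lemma qchar_le1 x : -1 <= qchar x <= 1.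
Proof. by rewrite /qchar; case: ifP => //; case: ifP. Qed.

Lemma qchar_prod (I : finType) (S : {set I}) (v : I -> F) :
  qchar (\prod_(i in S) v i) = \prod_(i in S) qchar (v i).
Proof. exact: (big_morph qchar qcharM qchar1). Qed.

Lemma charsum_le (g : {poly F}) l :
    (forall x, g.[x] != 0) ->
    (forall a (h k : {poly F}), h ^+ 2 * g = a *: k ^+ 2 -> h = 0) ->
    (10 <= l)%N -> (2 * (size g).-1 <= l)%N -> (l * l <= q)%N ->
    (q <= l * (l + 2))%N ->
  `|\sum_x qchar g.[x]| <= (charsum_bound (size g).-1 l)%:Z.
Proof.
move=> g_noroot g_nonsq l10 dl lq ql.
have le_fiber e := @card_character_fiber g g_noroot g_nonsq e l l10 dl lq ql.
pose N e := #|[set x | g.[x] ^+ M == e]|.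
have qcharE x : qchar g.[x] = (g.[x] ^+ M == 1)%:Z - (g.[x] ^+ M == -1)%:Z.
  rewrite /qchar (negPf (g_noroot x)).
  by case: (euler_criterion q_odd (g_noroot x)) => ->;
    rewrite ?eqxx ?(negPf oppr1_neq1) // eq_sym (negPf oppr1_neq1).
have sumE e : \sum_x (g.[x] ^+ M == e)%:Z = (N e)%:Z.
  rewrite /N -sum1_card -[RHS]natz natr_sum [RHS]big_mkcond /=; apply: eq_bigr => x _.
  by rewrite inE; case: eqP.
have N_sum : (N 1%R + N (-1)%R = q)%N.
  rewrite -(cardsC [set x | g.[x] ^+ M == 1]); congr (_ + _)%N.
  apply: eq_card => x; rewrite !inE.
  case: (euler_criterion q_odd (g_noroot x)) => ->;
    by rewrite ?eqxx ?(negPf oppr1_neq1) // eq_sym (negPf oppr1_neq1).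
under eq_bigr => x _ do rewrite qcharE.
rewrite sumrB !sumE; move: (le_fiber 1) (le_fiber (-1)).
rewrite -/(N 1) -/(N (-1)) -N_sum; move: (charsum_bound _ _) => E.
by move: (N 1) (N (-1)) => a b le1 le2; rewrite ler_norml; apply/andP; split; lia.
Qed.

(** The product over [i] of the factors [1 - qchar (G i).[x]] is nonnegative, and
    equal to [2 ^ m] on [T].  Its expansion consists of the constant [1], whose
    sum over [F] is [q], and of [2 ^ m - 1] terms whose sums are character
    sums. *)
Lemma card_all_nonsquares m D l (G : 'I_m -> {poly F}) (T : {set F}) :
    (0 < D)%N -> (10 <= l)%N -> (2 * (m * D.+1) <= l)%N -> (l * l <= q)%N ->
    (q <= l * (l + 2))%N ->
    injective G -> (forall i, irreducible_poly (G i)) ->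
    (forall i, G i \is monic) -> (forall i, size (G i) = D.+2) ->
    {in T, forall x i, (G i).[x] ^+ M = -1} ->
  (2 ^ m * #|T| <= q + 2 ^ m * charsum_bound (m * D.+1) l)%N.
Proof.
move=> D0 l10 Dl lq ql G_inj G_irr G_mon G_size T_ns.
pose B := charsum_bound (m * D.+1) l.
pose g (S : {set 'I_m}) := \prod_(i in S) G i.
have G_noroot i x : (G i).[x] != 0.
  apply/negP; rewrite -[_ == 0]/(root (G i) x) -dvdp_XsubCl => /((G_irr i).2 _).
  rewrite size_XsubC => /(_ isT) /eqp_size; rewrite size_XsubC G_size.
  by move/eqP; rewrite eqSS eqSS eq_sym (gtn_eqF D0).
have sum_g S : S != set0 -> `|\sum_x qchar (g S).[x]| <= B%:Z.
  move=> S0.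
  have size_gS : ((size (g S)).-1 = #|S| * D.+1)%N.
    rewrite size_prod => [|i _]; last by apply: irredp_neq0.
    rewrite (eq_bigr (fun=> D.+2)) => [|i _]; last exact: G_size.
    by rewrite sum_nat_const mulnS -addnS addKn.
  have le_m : (#|S| * D.+1 <= m * D.+1)%N.
    by rewrite leq_mul2r -[leqRHS]card_ord max_card.
  have := @charsum_le (g S) l; rewrite size_gS => /(_ _ _ l10 _ lq ql) le_B.
  apply: le_trans (le_B _ _ _) _ => [x|a h k||].
  - by rewrite horner_prod; apply/prodf_neq0 => i _; apply: G_noroot.
  - apply: prod_irreducible_nonsquare S0 => // i j _ _; exact: G_inj.
  - lia.
  - by rewrite lez_nat /B /charsum_bound leq_add // ?leq_mul2r ?leq_mul2l; lia.
have expand x : \prod_i (1 - qchar (G i).[x]) =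
    \sum_(S : {set 'I_m}) (-1) ^+ #|S| * qchar (g S).[x].
  under eq_bigr => i _ do rewrite addrC.
  rewrite bigA_distr; apply: eq_bigr => S _.
  rewrite -big_mkcond /= horner_prod qchar_prod -prodrN.
  by under eq_bigr => i _ do rewrite -mulN1r.
have lower : (2 ^ m * #|T|)%:Z <= \sum_x \prod_i (1 - qchar (G i).[x]).
  rewrite (bigID (mem T)) /= -[leLHS]addr0 lerD //; last first.
    apply: sumr_ge0 => x _; apply: prodr_ge0 => i _; rewrite subr_ge0.
    by case/andP: (qchar_le1 (G i).[x]).
  rewrite (eq_bigr (fun=> (2 ^ m)%:Z)) => [|x xT].
    by rewrite sumr_const -mulr_natr PoszM natz.
  rewrite (eq_bigr (fun=> 2%:Z)) => [|i _].
    by rewrite prodr_const card_ord -!natz natrX.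
  by rewrite /qchar (negPf (G_noroot i x)) (T_ns x xT i) (negPf oppr1_neq1).
have upper : \sum_x \prod_i (1 - qchar (G i).[x]) <= (q + 2 ^ m * B)%:Z.
  under eq_bigr => x _ do rewrite expand.
  rewrite exchange_big /= (bigD1 set0) //= PoszD lerD //.
    under eq_bigr => x _ do rewrite cards0 expr0 mul1r /g big_set0 hornerC qchar1.
    by rewrite sumr_const -mulr_natr mul1r natz.
  apply: (@le_trans _ _ (\sum_(S : {set 'I_m} | S != set0) B%:Z)).
    apply: ler_sum => S /sum_g; rewrite -mulr_sumr => le_S.
    apply: le_trans (ler_norm _) _; rewrite normrM normrX normrN1 expr1n.
    by rewrite mul1r.
  rewrite sumr_const -mulr_natr mulrC PoszM natz ler_wpM2r //.
  rewrite lez_nat (leq_trans (max_card _)) //.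
  by rewrite -cardsT -powersetT card_powerset cardsT card_ord.
by have := le_trans lower upper; rewrite lez_nat.
Qed.

End QuadraticCharacter.

(** * Nonsquare values on the orbit *)

Section Orbit.

Variables (F : finFieldType) (r : nat) (f : 'I_r -> {poly F}) (b c : 'I_r -> F).
Hypothesis f_def : forall i, f i = ('X - (b i)%:P) ^+ 2 + (c i)%:P.
Hypothesis f_irr : dynamically_irreducible f.
Hypotheses (F2 : 2%:R != 0 :> F) (q_odd : odd #|F|).

Lemma orbit_valuesP x :
  x \in orbit_values f c -> exists s j, x = (word_comp f s).[c j].
Proof.
rewrite !inE => /orP[/imsetP[j _ ->]|]; last by case/asboolP=> s [j [_ ->]]; exists s, j.
by exists [::], j; rewrite hornerX.
Qed.

Lemma word_comp_orbit_nonsquare s x :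
    s != [::] -> x \in orbit_values f c ->
  (word_comp f s).[x] ^+ #|F|./2 = -1.
Proof.
move=> s_n0 /orbit_valuesP[u [j ->]].
rewrite -horner_comp -word_comp_cat; set t := s ++ u.
have t_n0 : t != [::] by rewrite /t; case: (s) s_n0.
apply: (@irreducible_comp_nonsquare F _ (b j)) => //.
- exact: f_irr.
- exact: (monic_word_comp f_def).
- by rewrite (size_word_comp f_def) /= oddX orbF size_eq0.
- rewrite -f_def -[f j]comp_polyXr -[_ \Po 'X]/(word_comp f [:: j]).
  by rewrite -word_comp_cat; apply: f_irr; case: (t).
Qed.

Lemma card_orbit_values m k l (i0 i1 : 'I_r) :
    f i0 != f i1 -> (0 < k)%N -> (m <= 2 ^ k)%N -> (10 <= l)%N ->
    (2 * (m * 2 ^ k) <= l)%N -> (l * l <= #|F|)%N -> (#|F| <= l * (l + 2))%N ->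
  (2 ^ m * #|orbit_values f c| <= #|F| + 2 ^ m * charsum_bound (m * 2 ^ k) l)%N.
Proof.
move=> f01 k_gt0 mk l10 le_l lq ql.
have m_le : (m <= #|{: k.-tuple bool}|)%N by rewrite card_tuple card_bool.
pose letter (e : bool) := if e then i1 else i0.
pose wd (i : 'I_m) : seq 'I_r := map letter (enum_val (widen_ord m_le i)).
have size_wd i : size (wd i) = k by rewrite size_map size_tuple.
have i01 : i0 != i1 by apply: contra_neq f01 => ->.
have letter_inj : injective letter.
  by case=> [] [] //= /eqP; rewrite ?(negPf i01) // eq_sym (negPf i01).
have wd_in i : all (pred2 i0 i1) (wd i).
  by apply/allP=> _ /mapP[[] _ ->] /=; rewrite eqxx ?orbT.
have wd_inj : injective wd.
  move=> i j /(inj_map letter_inj) /val_inj /enum_val_inj /(congr1 val) /= E.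
  exact: val_inj.
have [D DE] : exists D, (2 ^ k = D.+1)%N.
  by exists (2 ^ k).-1; rewrite prednK ?expn_gt0.
have D_gt0 : (0 < D)%N by rewrite -ltnS -DE (ltn_exp2l 0).
rewrite DE in le_l *.
apply: (card_all_nonsquares F2 q_odd (G := fun i => word_comp f (wd i))
  D_gt0 l10 le_l lq ql).
- move=> i j /(word_comp_inj f_def F2 f01 (wd_in i) (wd_in j)) E.
  by apply/wd_inj/E; rewrite !size_wd.
- by move=> i; apply: f_irr; rewrite -size_eq0 size_wd -lt0n.
- by move=> i; apply: (monic_word_comp f_def).
- by move=> i; rewrite (size_word_comp f_def) size_wd DE.
- move=> x xT i; apply: word_comp_orbit_nonsquare => //.
  by rewrite -size_eq0 size_wd -lt0n.
Qed.

End Orbit.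

(** * Numerical estimates *)

Section Numeric.

Variable R : realType.

(** From [exp (1 / 15) <= 15 / 14] and [(15 / 14) ^ 10 <= 2]. *)
Lemma ln2_ge : 2 / 3 <= ln 2 :> R.
Proof.
have e15 : expR (15%:R^-1) <= 15 / 14 :> R.
  have := expR_ge1Dx (- 15%:R^-1 : R); rewrite expRN => le.
  rewrite -[expR _]invrK -[leRHS]invrK lef_pV2 ?posrE ?invr_gt0 ?expR_gt0 //; last by lra.
  apply: le_trans le; lra.
rewrite -ler_expR lnK ?posrE ?ltr0n // (_ : 2 / 3 = 10%:R * 15%:R^-1); last by lra.
rewrite expRM_natl; apply: le_trans (_ : (15 / 14) ^+ 10 <= _).
  by rewrite lerXn2r ?nnegrE ?expR_ge0 //; lra.
lra.
Qed.

Lemma ln_ge_pow4 (m q : nat) : (4 ^ m <= q)%N -> 4 / 3 * m%:R <= ln q%:R :> R.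
Proof.
move=> le_q.
have : ln ((4 ^ m)%N%:R) <= ln q%:R :> R.
  rewrite ler_ln ?posrE ?ltr0n ?ler_nat ?expn_gt0 //.
  by apply: leq_trans le_q; rewrite expn_gt0.
have -> : (4 ^ m)%N%:R = 2 ^+ (2 * m) :> R.
  by rewrite natrX exprM; congr (_ ^+ m); rewrite expr2; lra.
rewrite lnXn // -[_ *+ _]mulr_natr natrM; apply: le_trans.
have : 0 <= (ln 2 - 2 / 3) * m%:R :> R by rewrite mulr_ge0 ?subr_ge0 ?ln2_ge.
lra.
Qed.

End Numeric.

Lemma leq_sqr_pow2 m : (8 <= m)%N -> (4 * (m * m) <= 2 ^ m)%N.
Proof.
elim: m => // m IH; rewrite leq_eqVlt => /orP[/eqP <- //|]; rewrite ltnS => m8.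
rewrite expnS; apply: leq_trans (_ : 2 * (4 * (m * m)) <= _)%N; last first.
  by rewrite leq_mul2l IH.
have : (8 * m <= m * m)%N by rewrite leq_mul2r m8 orbT.
lia.
Qed.

Lemma nat_sqrt_exists q : exists l, (l * l <= q)%N /\ (q <= l * (l + 2))%N.
Proof.
elim: q => [|q [l [le1 le2]]]; first by exists 0.
have [le|lt] := leqP q.+1 (l * (l + 2)); first by exists l; split=> //; lia.
by exists l.+1; split; lia.
Qed.

(** * The bound on the orbit *)

Theorem theorem3 (R : realType) (F : finFieldType) (r : nat)
  (f : 'I_r -> {poly F}) (b c : 'I_r -> F) :
  2%N \notin [pchar F] ->
  (2 <= r)%N ->
  injective f ->
  (forall i, f i = ('X - (b i)%:P) ^+ 2 + (c i)%:P) ->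
  dynamically_irreducible f ->
  (#|orbit_values f c|)%:R <= 4 * ln (#|F|%:R : R) ^+ 2 * Num.sqrt #|F|%:R.
Proof.
move=> F2' r2 f_inj f_def f_irr.
have F2 : 2%:R != 0 :> F by apply: contra F2' => F20; rewrite inE /= F20.
have q_odd : odd #|F|.
  have [p p_pr pF] := finPcharP F.
  rewrite (card_pprimeChar pF) oddX; apply/orP; right.
  by have [E|//] := even_prime p_pr; move: F2'; rewrite -E pF.
have q3 : (3 <= #|F|)%N.
  by have := finNzRing_gt1 F; move: q_odd; case: #|F| => [|[|[]]].
have f01 : f (Ordinal (ltnW r2)) != f (Ordinal r2).
  by apply/negP => /eqP /f_inj /(congr1 val).
have := card_orbit_values f_def f_irr F2 q_odd f01.
have : (#|orbit_values f c| <= #|F|)%N by apply: max_card.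
move: #|orbit_values f c| #|F| q3 {q_odd} => N q q3 Nq main.
pose m := trunc_log 4 q.
have q_gt0 : (0 < q)%N by apply: ltn_trans q3.
have /andP[le_q lt_q] : (4 ^ m <= q < 4 ^ m.+1)%N by apply: trunc_log_bounds.
have L_ge := ln_ge_pow4 R le_q.
set L := ln _ in L_ge *; set s := Num.sqrt _.
have s_ge0 : 0 <= s by apply: sqrtr_ge0.
have s2 : s ^+ 2 = q%:R by rewrite sqr_sqrtr // ler0n.
have s_lt : s < 2 ^+ m.+1.
  rewrite -(ltr_pXn2r (n := 2)) // ?nnegrE ?exprn_ge0 // s2.
  by rewrite -exprM mulnC exprM -natrX -natrX ltr_nat.
have m_ge0 : 0 <= m%:R :> R by [].
have L_sqr : 64 / 9 * m%:R ^+ 2 <= 4 * L ^+ 2 by nra.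
have [m8|m8] := ltnP m 8.
  (* the trivial bound [q] suffices *)
  apply: le_trans (_ : s ^+ 2 <= _); first by rewrite s2 ler_nat.
  rewrite expr2 ler_wpM2r //.
  have [m0|m_gt0] := posnP m.
    have L_ge2 : 2 / 3 <= L.
      apply: le_trans (ln2_ge R) _; rewrite ler_ln ?posrE ?ltr0n // ler_nat.
      exact: ltnW.
    have : q%:R <= 3%:R :> R by rewrite ler_nat -ltnS; move: lt_q; rewrite m0.
    rewrite -s2 => s_le.
    have s_le1 : s <= 16 / 9.
      rewrite -(ler_pXn2r (n := 2)) ?nnegrE //; last by lra.
      apply: le_trans s_le _; lra.
    have : (2 / 3) ^+ 2 <= L ^+ 2 by rewrite lerXn2r ?nnegrE //; lra.
    lra.
  apply: le_trans (ltW s_lt) _; apply: le_trans L_sqr.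
  case: (m) m8 m_gt0 => [|[|[|[|[|[|[|[|m']]]]]]]] // _ _; lra.
pose k := up_log 2 m.
have [k_gt0 mk kM] : [/\ (0 < k)%N, (m <= 2 ^ k)%N & (2 ^ k <= 2 * m)%N].
  have /andP[lt1 le1] : (2 ^ k.-1 < m <= 2 ^ k)%N by apply: up_log_bounds; rewrite // (leq_trans _ m8).
  have k_gt0 : (0 < k)%N.
    by rewrite lt0n; apply: contraTneq le1 => ->; rewrite expn0 -ltnNge (leq_trans _ m8).
  by split=> //; rewrite -(prednK k_gt0) expnS leq_mul2l ltnW.
have [l [lq ql]] := nat_sqrt_exists q.
have pow_m := leq_sqr_pow2 m8.
have l_ge : (2 ^ m <= l)%N.
  rewrite leqNgt; apply/negP => l_lt.
  have : (l.+1 * l.+1 <= 2 ^ m * 2 ^ m)%N by apply: leq_mul.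
  by rewrite -expnMn => /leq_trans/(_ le_q)/leq_trans/(_ ql); lia.
have mD_le : (m * 2 ^ k <= 2 * (m * m))%N.
  by rewrite mulnCA leq_mul2l kM orbT.
have mm64 : (64 <= m * m)%N by apply: (leq_mul m8 m8).
have := main m k l k_gt0 mk.
have -> : (10 <= l)%N by lia.
have -> : (2 * (m * 2 ^ k) <= l)%N by lia.
move=> /(_ isT isT lq ql) {main} main.
have bound_le : (charsum_bound (m * 2 ^ k) l <= (6 * (m * m) + 8) * l)%N.
  rewrite /charsum_bound; move: mD_le; move: (m * 2 ^ k)%N => d d_le.
  have : ((3 * d + 3) * (l + 2) <= (6 * (m * m) + 3) * (l + 2))%N.
    by rewrite leq_mul2r; apply/orP; right; lia.
  lia.
have s_gt0 : 0 < s by rewrite lt0r s_ge0 andbT -sqrf_eq0 s2 pnatr_eq0 -lt0n.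
have l_le : l%:R <= s by rewrite -(ler_pXn2r (n := 2)) ?nnegrE // s2 -natrX ler_nat.
have {}main : 2 ^+ m * N%:R <= s ^+ 2 + 2 ^+ m * ((6 * m%:R ^+ 2 + 8) * s).
  have := leq_trans main (leq_add (leqnn _) (leq_mul (leqnn _) bound_le)).
  rewrite -(ler_nat R) !(natrD, natrM, natrX) -s2 => /le_trans; apply.
  rewrite lerD2l ler_wpM2l ?exprn_ge0 // -expr2 ler_wpM2l //.
  by rewrite addr_ge0 // mulr_ge0 // exprn_ge0.
have N_le : N%:R <= (6 * m%:R ^+ 2 + 10) * s.
  rewrite -(ler_pM2l (x := 2 ^+ m)) ?exprn_gt0 //; apply: le_trans main _.
  rewrite [X in _ <= X](_ : _ = 2 ^+ m.+1 * s
    + 2 ^+ m * ((6 * m%:R ^+ 2 + 8) * s)); last by rewrite (exprS _ m); ring.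
  by rewrite lerD2r expr2 ler_wpM2r // ltW.
apply: le_trans N_le _; rewrite ler_wpM2r //; apply: le_trans L_sqr.
have : 8%:R <= m%:R :> R by rewrite ler_nat.
nra.
Qed.
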